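(* Let $X \colon \mathbf{CommRing} \to \mathbf{Set}$ be a functor that is tame and multiplicative. Then, as formal Dirichlet series, \[ \widehat{Z}_X(s) = \prod_{p \in \mathbb{P}} \exp\left( \sum_{n \ge 1} \frac{|X(\mathbb{F}_{p^n})|}{n}\, p^{-ns} \right), \] where $\mathbb{P}$ is the set of prime numbers and $\mathbb{F}_{p^n}$ is the field with $p^n$ elements.
   Context: $\mathbf{CommRing}$ is the category of commutative rings. A functor $X\colon \mathbf{CommRing}\to\mathbf{Set}$ is called tame if $X(k)$ is a finite set whenever $k$ is a finite semisimple commutative ring (equivalently, a finite product of finite fields, including the one-element ring as the empty product), and multiplicative if it preserves products. A species is a functor from the groupoid of finite sets and bijections to $\mathbf{Set}$; it is tame if all its values are finite sets. The zeta species $Z_X$ of $X$ is the species such that $Z_X(S)$, for a finite set $S$, is the set of pairs consisting of a way to make $S$ into a semisimple commutative ring, say $k$ (i.e. a choice of addition and multiplication on $S$ making it such a ring), and an element of $X(k)$; bijections act by transport of structure. For a tame species $F$, its Dirichlet series is the formal series $\widehat{F}(s)=\sum_{n\ge1}\frac{|F(n)|}{n!}n^{-s}$, where $F(n)$ denotes the value of $F$ on an $n$-element set. Formal Dirichlet series $\sum_{n\ge1}a_n n^{-s}$ are multiplied by $(\sum a_n n^{-s})(\sum b_m m^{-s})=\sum_N(\sum_{nm=N}a_nb_m)N^{-s}$; for a series $f$ with zero coefficient of $1^{-s}$, $\exp(f)=\sum_{m\ge0}f^m/m!$; an infinite product over primes of series each of which has coefficient $1$ at $1^{-s}$ and nonzero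 other coefficients only at powers of $p$ is defined coefficientwise (each coefficient involves only finitely many factors nontrivially). *)

(* Defs.v *)
From HB Require Import structures.
From mathcomp Require Import all_boot all_order all_algebra all_field.
From Stdlib Require Import ClassicalEpsilon.
Set Implicit Arguments. Unset Strict Implicit. Unset Printing Implicit Defensive.
Import GRing.Theory.
Local Open Scope ring_scope.

Definition has_card (T : Type) (m : nat) : Prop :=
  exists f : T -> 'I_m, bijective f.
Definition finite_type (T : Type) : Prop := exists m, has_card T m.
(* |T| : the number of elements of T (meaningful when T is finite) *)
Definition fcard (T : Type) : nat := epsilon (inhabits 0%N) (has_card T).

(* CommRing = commutative rings with 1 (zero ring allowed) = comPzRingType,
   morphisms = unital ring morphisms = {rmorphism R -> S}. *)
Record functor := Functor {
  Fobj :> comPzRingType -> Type;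
  Fmap : forall R S : comPzRingType, {rmorphism R -> S} -> Fobj R -> Fobj S;
  Fmap_id : forall (R : comPzRingType) (f : {rmorphism R -> R}),
      (forall x, f x = x) -> forall a, Fmap f a = a;
  Fmap_comp : forall (R S T : comPzRingType) (f : {rmorphism R -> S})
      (g : {rmorphism S -> T}) (h : {rmorphism R -> T}),
      (forall x, h x = g (f x)) -> forall a, Fmap h a = Fmap g (Fmap f a)
}.
Arguments Fmap _ {R S} _ _.

Definition finite_semisimple (k : comPzRingType) : Prop :=
  exists (m : nat) (F : 'I_m -> finFieldType) (phi : k -> forall i, F i),
    [/\ bijective phi,
        (forall x y i, phi (x + y) i = phi x i + phi y i),
        (forall x y i, phi (x * y) i = phi x i * phi y i) &
        (forall i, phi 1 i = 1)].

Definition tame (X : functor) : Prop :=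
  forall k : comPzRingType, finite_semisimple k -> finite_type (X k).

(* preserves (finite) products: terminal object and binary products *)
Definition multiplicative (X : functor) : Prop :=
  (forall Z : comPzRingType, (1 : Z) = 0 -> exists x : X Z, forall y, y = x) /\
  (forall R S : comPzRingType,
      bijective (fun a : X (R * S)%type => (Fmap X fst a, Fmap X snd a))).

Record cring_axioms (n : nat) (add mul : 'I_n -> 'I_n -> 'I_n)
    (z o : 'I_n) (opp : 'I_n -> 'I_n) : Prop := CringAxioms {
  ax_addA : associative add;
  ax_addC : commutative add;
  ax_add0 : left_id z add;
  ax_addN : left_inverse z opp add;
  ax_mulA : associative mul;
  ax_mulC : commutative mul;
  ax_mul1 : left_id o mul;
  ax_mulDl : left_distributive mul add }.

Record ring_str (n : nat) := RingStr {
  radd : {ffun 'I_n * 'I_n -> 'I_n};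
  rmul : {ffun 'I_n * 'I_n -> 'I_n};
  rax : exists d : 'I_n * 'I_n * ('I_n -> 'I_n),
      cring_axioms (fun x y => radd (x, y)) (fun x y => rmul (x, y)) d.1.1 d.1.2 d.2 }.

Definition rdata n (s : ring_str n) : 'I_n * 'I_n * ('I_n -> 'I_n) :=
  proj1_sig (constructive_indefinite_description _ (rax s)).
Lemma rdataP n (s : ring_str n) :
  cring_axioms (fun x y => radd s (x, y)) (fun x y => rmul s (x, y))
    (rdata s).1.1 (rdata s).1.2 (rdata s).2.
Proof. exact: proj2_sig (constructive_indefinite_description _ (rax s)). Qed.

Definition rcarrier n (s : ring_str n) : Type := 'I_n.
HB.instance Definition _ n (s : ring_str n) := Finite.copy (rcarrier s) 'I_n.
HB.instance Definition _ n (s : ring_str n) :=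
  GRing.isZmodule.Build (rcarrier s) (ax_addA (rdataP s)) (ax_addC (rdataP s))
    (ax_add0 (rdataP s)) (ax_addN (rdataP s)).
HB.instance Definition _ n (s : ring_str n) :=
  GRing.Zmodule_isComPzRing.Build (rcarrier s) (ax_mulA (rdataP s))
    (ax_mulC (rdataP s)) (ax_mul1 (rdataP s)) (ax_mulDl (rdataP s)).
Definition ring_of n (s : ring_str n) : comPzRingType := rcarrier s.

Definition zeta_species (X : functor) (n : nat) : Type :=
  { s : { s : ring_str n | finite_semisimple (ring_of s) } & X (ring_of (sval s)) }.

(* ---------- formal Dirichlet series over Q: coefficient of n^{-s} ---------- *)
Definition dser := nat -> rat.
Definition dmul (f g : dser) : dser :=
  fun N => \sum_(d <- divisors N) f d * g (N %/ d)%N.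
Definition done : dser := fun N => (N == 1)%N%:R.
(* exp(f) = sum_{m>=0} f^m/m!, for f with zero coefficient at 1^{-s};
   the N-th coefficient only involves m <= N since f^m vanishes below 2^m *)
Definition dexp (f : dser) : dser :=
  fun N => \sum_(m < N.+1) iter m (dmul f) done N / (m`!)%:R.
(* infinite product over primes, coefficientwise: the N-th coefficient only
   involves the factors with p <= N *)
Definition dprod_primes (F : nat -> dser) : dser :=
  fun N => (\big[dmul/done]_(0 <= p < N.+1 | prime p) F p) N.

Definition zeta_hat (X : functor) : dser :=
  fun N => (fcard (zeta_species X N))%:R / (N`!)%:R.

Definition Fpn (p n : nat) : finFieldType :=
  match Sumbool.sumbool_of_bool (prime p), Sumbool.sumbool_of_bool (0 < n)%N with
  | left hp, left hn => s2val (pPrimePowerField hp hn)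
  | _, _ => ('F_2 : finFieldType)
  end.

(* sum_{n>=1} |X(F_{p^n})|/n p^{-ns} *)
Definition log_factor (X : functor) (p : nat) : dser :=
  fun N => if (1 < N)%N && (N == p ^ logn p N)%N
           then (fcard (X (Fpn p (logn p N))))%:R / (logn p N)%:R
           else 0.

(* Main.v *)
Require Import Defs.
From HB Require Import structures.
From mathcomp Require Import all_boot all_order all_algebra all_field.
From mathcomp Require Import all_fingroup all_solvable boolp ring.
Local Open Scope ring_scope.

(** Let Omega be the completely additive weight counting prime factors with multiplicity, so
    that [D f n = Omega n * f n] is a derivation for Dirichlet convolution.  Both sides take
    the value 1 at 1, and a series with this property is determined by [D g = h * g]; the Euler
    product satisfies this equation with [h] the sum of the [D (log_factor p)].

    For the zeta species, a finite semisimple ring with [N] elements has primitive idempotents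
    [e] whose blocks [e R] are fields with [\sum_e Omega #|e R| = Omega N].  The triples (ring
    structure, point of [X], primitive idempotent with block of size [q = p^n]) are counted
    through the bijections from ['I_N] onto [F_q * 'I_M], [N = q * M]: every such bijection,
    together with a ring structure on ['I_M], induces a ring structure with a distinguished
    primitive idempotent, and each pair (ring structure, idempotent) is hit [n * M!] times, since
    there are [n] isomorphisms from its block to [F_q] and [M!] labellings of the
    complementary factor. *)

(* A section keeps [GRing.Theory] local: imported globally, it hides [Defs.multiplicative]. *)
Section EulerProduct.
Set Implicit Arguments. Unset Strict Implicit. Unset Printing Implicit Defensive.
Import GRing.Theory Num.Theory.

(** * Dirichlet series *)

(** Over a box of pairs the index sets are independent, so sums can be exchanged. The bound [K] may
    exceed [N], since in a triple product one box has to serve every inner coefficient. *)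
Lemma dmulE (K N : nat) (f g : dser) : (0 < N <= K)%N ->
  dmul f g N = \sum_(a < K.+1) \sum_(b < K.+1 | (a * b == N)%N) f a * g b.
Proof.
case/andP=> N0 NK; rewrite /dmul.
have -> : \sum_(a < K.+1) \sum_(b < K.+1 | (a * b == N)%N) f a * g b =
  \sum_(a < K.+1 | (a %| N)%N) f a * g (N %/ a)%N.
  rewrite [RHS]big_mkcond; apply: eq_bigr => a _.
  case: ifP => [aN|naN].
    have lt : (N %/ a < K.+1)%N by rewrite ltnS (leq_trans (leq_div _ _)).
    have a0 : (0 < a)%N by apply: dvdn_gt0 aN.
    rewrite (big_pred1 (Ordinal lt)) // => b /=.
    have -> : (b == Ordinal lt) = (nat_of_ord b == N %/ a)%N by [].
    by rewrite eqn_div // mulnC.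
  rewrite big_pred0 // => b; apply/negbTE/eqP => abN.
  by move: naN; rewrite -abN dvdn_mulr.
rewrite -(big_mkord (fun a => (a %| N)%N) (fun a => f a * g (N %/ a)%N)).
rewrite -big_filter; apply: perm_big; apply: uniq_perm.
- exact: divisors_uniq.
- by rewrite filter_uniq // iota_uniq.
move=> d; rewrite mem_filter mem_index_iota -dvdn_divisors // ltnS.
case dN: (d %| N)%N => //=.
by rewrite (leq_trans (dvdn_leq N0 dN)).
Qed.

(* [dmul f g 0] is the junk value [f 1 * g 0], since [divisors 0 = [:: 1]];
   clearing it makes the product commutative and associative on the nose. *)
Definition cmul (f g : dser) : dser := fun N => if N is 0 then 0 else dmul f g N.

Lemma cmul_pos f g N : (0 < N)%N -> cmul f g N = dmul f g N.
Proof. by case: N. Qed.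

Lemma cmulE (K N : nat) (f g : dser) : (0 < N <= K)%N ->
  cmul f g N = \sum_(a < K.+1) \sum_(b < K.+1 | (a * b == N)%N) f a * g b.
Proof. by case/andP=> N0 NK; rewrite cmul_pos // (dmulE (K := K)) ?N0. Qed.

Lemma dser_ext (f g : dser) : f 0%N = g 0%N ->
  (forall N, (0 < N)%N -> f N = g N) -> f = g.
Proof. by move=> e0 e; apply: funext => -[|N] //; apply: e. Qed.

Lemma cmulC f g : cmul f g = cmul g f.
Proof.
apply: dser_ext => // N N0; rewrite !(cmulE (K := N)) ?N0 //=.
under eq_bigr do rewrite big_mkcond.
rewrite exchange_big; apply: eq_bigr => a _; rewrite [RHS]big_mkcond.
by apply: eq_bigr => b _; rewrite mulnC [f b * _]mulrC.
Qed.

(** In this form the three indices enter symmetrically, and associativity becomes a permutation of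
    sums. *)
Lemma cmul3E f g h N : (0 < N)%N -> cmul f (cmul g h) N =
  \sum_(a < N.+1) \sum_(b < N.+1) \sum_(c < N.+1 | (a * (b * c) == N)%N)
    f a * (g b * h c).
Proof.
move=> N0; rewrite (cmulE (K := N)) ?N0 //=; apply: eq_bigr => a _.
transitivity (\sum_(k < N.+1 | (a * k == N)%N) \sum_(b < N.+1)
   \sum_(c < N.+1 | (b * c == k)%N) f a * (g b * h c)).
  apply: eq_bigr => k /eqP akN.
  have k0 : (0 < k)%N by move: (N0); rewrite -{1}akN muln_gt0 => /andP[].
  rewrite (cmulE (K := N)) ?k0 -1?ltnS ?ltn_ord // mulr_sumr.
  by apply: eq_bigr => b _; rewrite mulr_sumr.
rewrite exchange_big; apply: eq_bigr => b _.
under eq_bigr do rewrite big_mkcond.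
rewrite exchange_big [RHS]big_mkcond; apply: eq_bigr => c _.
case: ifP => [/eqP abc|nabc].
  have a0 : (0 < a)%N by move: (N0); rewrite -{1}abc muln_gt0 => /andP[].
  have lt : (b * c < N.+1)%N by rewrite ltnS -[leqRHS]abc leq_pmull.
  rewrite (bigD1 (Ordinal lt)) /=; last by rewrite abc.
  rewrite eqxx big1 ?addr0 // => k /andP[_]; rewrite -val_eqE /= eq_sym.
  by move/negbTE=> ->.
rewrite big1 // => k /eqP akN; case: eqP => // bck.
by move: nabc; rewrite bck akN eqxx.
Qed.

Lemma cmulA f g h : cmul f (cmul g h) = cmul (cmul f g) h.
Proof.
apply: dser_ext => // N N0; rewrite [in RHS]cmulC !cmul3E //.
rewrite [RHS]exchange_big; apply: eq_bigr => a _ /=.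
under [RHS]eq_bigr do rewrite big_mkcond.
rewrite [RHS]exchange_big; apply: eq_bigr => b _ /=.
rewrite [LHS]big_mkcond; apply: eq_bigr => c _ /=.
by rewrite mulnA [(c * _)%N]mulnC [h _ * _]mulrC mulrA.
Qed.

Lemma cmulDl f g h : cmul (fun n => f n + g n) h = fun N => cmul f h N + cmul g h N.
Proof.
apply: funext => -[|N]; first by rewrite /= addr0.
rewrite /= /dmul -big_split; apply: eq_bigr => d _.
exact: mulrDl.
Qed.

Lemma cmul_sumr f (m : nat) (g : nat -> dser) N :
  cmul f (fun n => \sum_(i < m) g i n) N = \sum_(i < m) cmul f (g i) N.
Proof.
case: N => [|N]; first by rewrite big1.
by rewrite exchange_big; apply: eq_bigr => d _; rewrite mulr_sumr.
Qed.

Lemma cmulZr f c (g : dser) N : cmul f (fun n => c * g n) N = c * cmul f g N.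
Proof.
case: N => [|N]; first by rewrite /= mulr0.
by rewrite /= /dmul mulr_sumr; apply: eq_bigr => d _; rewrite mulrCA.
Qed.

Lemma cmulf0 f : cmul f (fun=> 0) = fun=> 0.
Proof.
by apply: funext => -[|N] //=; rewrite /dmul big1 // => d _; rewrite mulr0.
Qed.

Lemma cmul_at1 f g : cmul f g 1 = f 1%N * g 1%N.
Proof. by rewrite /= /dmul /= big_seq1. Qed.

Definition dpow (f : dser) m : dser := iter m (cmul f) done.

(** The divisor 1 contributes [f 1 = 0]; any other [d] leaves a cofactor [N %/ d < N], within reach
    of the induction on [m]. *)
Lemma dpow_eq0 f m N : f 1%N = 0 -> (0 < N <= m)%N -> dpow f m N = 0.
Proof.
move=> f1; elim: m N => [|m IH] N /andP[N0 Nm]; first by case: N N0 Nm.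
rewrite /dpow /= cmul_pos // /dmul big1_seq // => d /andP[_].
rewrite -dvdn_divisors // => dN.
have d0 : (0 < d)%N by apply: dvdn_gt0 dN.
have [->|d1] := eqVneq d 1%N; first by rewrite f1 mul0r.
rewrite [X in _ * X]IH ?mulr0 // divn_gt0 // dvdn_leq //=.
rewrite -ltnS (leq_trans _ Nm) // ltn_Pdiv //.
by case: d d0 d1 {dN} => [|[]].
Qed.

(** A coefficient at a positive index involves only positive indices, so the junk value at 0 never
    enters. *)
Lemma iter_dmul f m N : (0 < N)%N -> iter m (dmul f) done N = dpow f m N.
Proof.
elim: m N => [|m IH] N N0 //; rewrite /dpow /= cmul_pos //.
apply: eq_big_seq => d; rewrite -dvdn_divisors // => dN.
have d0 : (0 < d)%N by apply: dvdn_gt0 dN.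
by rewrite IH // divn_gt0 // dvdn_leq.
Qed.

Lemma big_dmul (F : nat -> dser) (r : seq nat) (P : pred nat) N : (0 < N)%N ->
  (\big[dmul/done]_(p <- r | P p) F p) N = (\big[cmul/done]_(p <- r | P p) F p) N.
Proof.
move=> N0; elim/big_rec2: _ N N0 => // p f g _ IH N N0.
rewrite cmul_pos //; apply: eq_big_seq => d; rewrite -dvdn_divisors // => dN.
have d0 : (0 < d)%N by apply: dvdn_gt0 dN.
by rewrite IH // divn_gt0 // dvdn_leq.
Qed.

(** The truncation point is free above [N], so that one choice serves all divisors of a given
    index. *)
Lemma dexpE f m N : f 1%N = 0 -> (0 < N <= m)%N ->
  dexp f N = \sum_(i < m) dpow f i N / (i`!)%:R.
Proof.
move=> f1 /andP[N0 Nm].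
have aux k : (N <= k)%N -> \sum_(i < k) dpow f i N / (i`!)%:R =
   \sum_(i < N) dpow f i N / (i`!)%:R.
  move=> Nk.
  rewrite -!(big_mkord xpredT (fun i => dpow f i N / (i`!)%:R)).
  rewrite (big_cat_nat (leq0n N) Nk) /= [X in _ + X]big1_seq ?addr0 // => i.
  rewrite mem_index_iota => /andP[_ /andP[Ni _]].
  by rewrite dpow_eq0 ?mul0r // N0.
rewrite aux // -(aux N.+1) //; apply: eq_bigr => i _; by rewrite iter_dmul.
Qed.

Lemma dexp_at1 f : f 1%N = 0 -> dexp f 1 = 1.
Proof.
by move=> f1; rewrite (dexpE (m := 1)) // big_ord1 /dpow /= /done divr1.
Qed.

Lemma dexp_at0 f : dexp f 0 = 0.
Proof. by rewrite /dexp big_ord1 /= /done mul0r. Qed.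

(** * Derivations given by additive weights, and logarithmic differentiation *)

Section Derivation.
Variable w : nat -> rat.
Hypothesis wM : forall a b, (0 < a)%N -> (0 < b)%N -> w (a * b)%N = w a + w b.
Definition dder (f : dser) : dser := fun n => w n * f n.

Let w1 : w 1%N = 0.
Proof. by apply: (addrI (w 1%N)); rewrite addr0 -wM. Qed.

Lemma dder_mul f g :
  dder (cmul f g) = fun N => cmul (dder f) g N + cmul f (dder g) N.
Proof.
apply: dser_ext => [|N N0]; first by rewrite /dder /= mulr0 addr0.
rewrite /dder !cmul_pos // /dmul mulr_sumr -big_split; apply: eq_big_seq => d.
rewrite -dvdn_divisors // => dN /=.
have d0 : (0 < d)%N by apply: dvdn_gt0 dN.
have Nd0 : (0 < N %/ d)%N by rewrite divn_gt0 // dvdn_leq.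
have -> : w N = w d + w (N %/ d)%N by rewrite -wM // mulnC divnK.
ring.
Qed.

Lemma dder_pow f m :
  dder (dpow f m.+1) = fun N => m.+1%:R * cmul (dder f) (dpow f m) N.
Proof.
have Dpow1 : dder done = fun=> 0.
  by apply: funext => -[|[|N]]; rewrite /dder /done ?mulr0 ?w1 ?mul0r.
elim: m => [|m IH].
  rewrite /dpow /= dder_mul Dpow1; apply: funext => N.
  by rewrite mul1r cmulf0 addr0.
rewrite {1}/dpow iterS -/(dpow f m.+1) dder_mul; apply: funext => N.
rewrite IH cmulZr.
rewrite cmulA [cmul f (dder f)]cmulC -cmulA -[cmul f (dpow f m)]/(dpow f m.+1).
by rewrite -(natr1 m.+1) mulrDl mul1r addrC.
Qed.

Lemma dder_exp f : f 1%N = 0 -> dder (dexp f) = cmul (dder f) (dexp f).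
Proof.
move=> f1; apply: dser_ext => [|N N0].
  by rewrite /dder dexp_at0 mulr0.
transitivity (\sum_(i < N) cmul (dder f) (dpow f i) N / (i`!)%:R).
  (* The left side is truncated one term later than the right: its term of degree 0 is killed by
     [w 1 = 0], and the shift by one then matches the two sums. *)
  rewrite /dder (dexpE (m := N.+1)) ?N0 ?leqnSn // mulr_sumr big_ord_recl.
  rewrite [X in X + _](_ : _ = 0) ?add0r; last first.
    rewrite /dpow /= /done; case: eqP => [->|_]; last by rewrite mul0r mulr0.
    by rewrite w1 mul0r.
  apply: eq_bigr => i _; rewrite /= mulrA -[w N * _]/(dder (dpow f i.+1) N).
  rewrite dder_pow factS natrM invfM.
  by rewrite mulrACA mulfV ?mul1r // pnatr_eq0.
transitivity (cmul (dder f) (fun n => \sum_(i < N) dpow f i n / (i`!)%:R) N).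
  rewrite (cmul_sumr _ N (fun i n => dpow f i n / (i`!)%:R)); apply: eq_bigr => i _.
  rewrite mulrC -cmulZr.
  by congr (cmul _ _ _); apply: funext => n; rewrite mulrC.
rewrite !cmul_pos //; apply: eq_big_seq => d; rewrite -dvdn_divisors // => dN.
have d0 : (0 < d)%N by apply: dvdn_gt0 dN.
by rewrite (dexpE (m := N)) // divn_gt0 // dvdn_leq //= leq_div.
Qed.

(** Logarithmic derivatives add up over products, and that of [dexp (L p)] is [dder (L p)]. *)
Lemma dder_prod_exp (L : nat -> dser) (r : seq nat) (P : pred nat) :
  (forall p, L p 1%N = 0) ->
  dder (\big[cmul/done]_(p <- r | P p) dexp (L p)) =
  cmul (dder (fun n => \sum_(p <- r | P p) L p n))
       (\big[cmul/done]_(p <- r | P p) dexp (L p)).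
Proof.
move=> L1; elim: r => [|p r IH].
  rewrite big_nil cmulC (_ : dder _ = fun=> 0); last first.
    by apply: funext => -[|[|N]]; rewrite /dder /done ?mulr0 ?w1 ?mul0r.
  rewrite (_ : dder _ = fun=> 0) ?cmulf0 //.
  by apply: funext => n; rewrite /dder big_nil mulr0.
rewrite big_cons; case Pp: (P p); last first.
  rewrite IH; congr (cmul _ _); apply: funext => n.
  by rewrite /dder big_cons Pp.
rewrite dder_mul IH dder_exp //.
have -> : dder (fun n => \sum_(j <- (p :: r) | P j) L j n) =
  fun n => dder (L p) n + dder (fun n => \sum_(p <- r | P p) L p n) n.
  by apply: funext => n; rewrite /dder big_cons Pp mulrDr.
rewrite cmulDl; apply: funext => N; congr (_ + _); first by rewrite cmulA.
by rewrite cmulA [cmul (dexp _) (dder _)]cmulC -cmulA.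
Qed.

Lemma prod_exp_at1 (L : nat -> dser) (r : seq nat) (P : pred nat) :
  (forall p, L p 1%N = 0) ->
  (\big[cmul/done]_(p <- r | P p) dexp (L p)) 1%N = 1.
Proof.
move=> L1; elim/big_rec: _ => // p f _ f1.
by rewrite cmul_at1 f1 dexp_at1 // mulr1.
Qed.

(** Since [h 1 = 0], the equation expresses [w n * f n] through values of [f] at proper divisors of
    [n], and [w n] can be cancelled. *)
Lemma dder_unique (K : nat) (h f g : dser) :
  (forall n, (1 < n <= K)%N -> w n != 0) -> h 1%N = 0 ->
  f 1%N = g 1%N ->
  (forall n, (0 < n <= K)%N -> dder f n = cmul h f n) ->
  (forall n, (0 < n <= K)%N -> dder g n = cmul h g n) ->
  forall n, (0 < n <= K)%N -> f n = g n.
Proof.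
move=> w0 h1 fg1 ff gg n; elim/ltn_ind: n => n IH nK.
have [->//|n1] := eqVneq n 1%N.
have n2 : (1 < n <= K)%N.
  by case/andP: nK => n0 ->; rewrite andbT ltn_neqAle eq_sym n1.
apply: (mulfI (w0 n n2)); rewrite -[LHS]/(dder f n) -[RHS]/(dder g n).
case/andP: (nK) => n0 nK'.
rewrite ff // gg // !cmul_pos //; apply: eq_big_seq => d; rewrite -dvdn_divisors // => dn.
have d0 : (0 < d)%N by apply: dvdn_gt0 dn.
have [->|d1] := eqVneq d 1%N; first by rewrite h1 !mul0r.
have nd0 : (0 < n %/ d)%N by rewrite divn_gt0 // dvdn_leq.
rewrite IH ?nd0 //= ?(leq_trans (leq_div _ _)) //.
by rewrite ltn_Pdiv // ltn_neqAle eq_sym d1.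
Qed.

End Derivation.

(** * Homomorphisms between finite fields *)

Section FiniteFieldHoms.
Variables (p n : nat) (K F : finFieldType).
Hypotheses (p_pr : prime p) (cardK : #|K| = (p ^ n)%N) (cardF : #|F| = (p ^ n)%N).

Definition is_field_hom (f : {ffun K -> F}) : bool :=
  [&& f 1 == 1, [forall x, forall y, f (x + y) == f x + f y] &
      [forall x, forall y, f (x * y) == f x * f y]].

Lemma is_field_homP (f : {ffun K -> F}) : reflect [/\ f 1 = 1, {morph f : x y / x + y} &
  {morph f : x y / x * y}] (is_field_hom f).
Proof.
apply: (iffP and3P) => [[/eqP f1 fD fM]|[f1 fD fM]]; split=> //.
- by move=> x y; move/forallP/(_ x)/forallP/(_ y)/eqP: fD.
- by move=> x y; move/forallP/(_ x)/forallP/(_ y)/eqP: fM.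
- exact/eqP.
- by apply/forallP => x; apply/forallP => y; apply/eqP.
- by apply/forallP => x; apply/forallP => y; apply/eqP.
Qed.

Let pcharK : p \in [pchar K] := card_finPcharP cardK p_pr.
Let pcharF : p \in [pchar F] := card_finPcharP cardF p_pr.
Let KL := pPrimeCharType pcharK.
Let FL := pPrimeCharType pcharF.
Let evK (z : K) (h : {poly 'F_p}) : KL := horner_alg (z : KL) h.
Let evF (z : F) (h : {poly 'F_p}) : FL := horner_alg (z : FL) h.

(** A homomorphism fixes the prime field, hence commutes with evaluation of polynomials over
    ['F_p]. *)
Lemma field_hom_eval (f : {ffun K -> F}) z h :
  is_field_hom f -> f (evK z h) = evF (f z) h.
Proof.
case/is_field_homP=> f1 fD fM.
have f0 : f 0 = 0 by apply: (addrI (f 0)); rewrite -fD !addr0.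
have fn k : f k%:R = k%:R by elim: k => [|k IH] //; rewrite -natr1 fD IH f1 natr1.
rewrite /evK /evF; elim/poly_ind: h => [|q c IH]; first by rewrite !rmorph0.
rewrite !rmorphD !rmorphM /= !horner_algX !horner_algC fD fM IH.
by congr (_ + _); rewrite [LHS]fM f1 fn.
Qed.

(** A generator of the cyclic unit group works: nonzero elements are values of monomials. *)
Lemma field_generator : exists z : K, forall x, exists h, evK z h = x.
Proof.
have /cyclicP[u Gu] := field_unit_group_cyclic [set: {unit K}]%G.
exists (val u) => x; have [->|x0] := eqVneq x 0.
  by exists 0; rewrite /evK rmorph0.
have : finField_unit x0 \in <[u]>%g by rewrite -Gu inE.
case/cycleP => i /(congr1 val) /= xE; exists 'X^i.
by rewrite /evK rmorphXn /= horner_algX xE FinRing.val_unitX.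
Qed.

(** Evaluation at a generator [z] identifies homomorphisms with the roots in [F] of the minimal
    polynomial of [z], which has degree [n] and splits over [F] with distinct roots. *)
Lemma card_field_hom : #|[set f | is_field_hom f]| = n.
Proof.
have [z zP] := field_generator.
(* The minimal polynomial [m] of [z] is taken as a nonzero annihilator of least size; ['X^#|K| - 'X]
   shows that one exists. *)
pose P k := `[< exists h, [/\ h != 0, evK z h = 0 & size h = k] >].
have exP : exists k, P k.
  exists (size ('X^#|K| - 'X : {poly 'F_p})); apply/asboolP.
  exists ('X^#|K| - 'X); split=> //.
    rewrite -size_poly_gt0 size_polyDl size_polyXn // size_polyN size_polyX.
    by rewrite ltnS finNzRing_gt1.
  rewrite /evK rmorphB rmorphXn /= horner_algX; apply/eqP; rewrite subr_eq0.
  by apply/eqP; exact: expf_card.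
case: (ex_minnP exP) => _ /asboolP[m [m0 mz <-]] mmin.
have mdvd h : evK z h = 0 -> m %| h.
  move=> hz; apply/eqP; apply: contraTeq isT => r0.
  have: (size m <= size (h %% m)%R)%N.
    apply: mmin; apply/asboolP; exists (h %% m); split=> //.
    have := congr1 (evK z) (divp_eq h m).
    by rewrite /evK rmorphD rmorphM /= -!/(evK _ _) hz mz mulr0 add0r => <-.
  by rewrite leqNgt ltn_modp m0.
have msz : (0 < size m)%N by rewrite size_poly_gt0.
(* Remainders modulo [m], encoded as row vectors over ['F_p], correspond bijectively to elements of
   [K]; counting both gives the degree. *)
have szm : (size m).-1 = n.
  pose g (v : 'rV['F_p]_(size m).-1) : K := evK z (rVpoly v).
  have lt_sz (v : 'rV['F_p]_(size m).-1) : (size (rVpoly v) < size m)%N.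
    by rewrite -[ltnRHS](prednK msz) ltnS size_poly.
  have g_inj : injective g.
    move=> u v; rewrite /g => uv.
    have /mdvd dv : evK z (rVpoly (u - v)) = 0.
      by rewrite linearB /evK rmorphB /= -!/(evK _ _) uv subrr.
    apply/eqP; rewrite -subr_eq0 -[u - v]rVpolyK; apply/eqP.
    suff -> : rVpoly (u - v) = 0 by rewrite linear0.
    apply/eqP; apply: contraTT dv => nz; apply/negP => /(dvdp_leq nz).
    by rewrite leqNgt lt_sz.
  have g_surj x : exists v, g v = x.
    have [h <-] := zP x; exists (poly_rV (h %% m)).
    rewrite /g poly_rV_K; last by rewrite -ltnS (prednK msz) ltn_modp.
    rewrite [in RHS](divp_eq h m) /evK rmorphD rmorphM /= -!/(evK _ _) mz.
    by rewrite mulr0 add0r.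
  have : #|'rV['F_p]_(size m).-1| = #|K|.
    rewrite -(card_codom g_inj); apply: eq_card => x; rewrite inE.
    by have [v <-] := g_surj x; apply: codom_f.
  rewrite card_mx card_Fp // cardK mul1n => /eqP.
  by rewrite eqn_exp2l ?prime_gt1 // => /eqP.
pose W := [set w : F | evF w m == 0].
(* [m] divides ['X^#|K| - 'X], which over [F] is the product of all ['X - x]; so [m] has as many
   roots in [F] as its degree. *)
have cardW : #|W| = n.
  pose mF := map_poly (in_alg FL) m.
  have mFE w : evF w m = mF.[w :> FL] by [].
  have : mF %| \prod_(x : FL) ('X - x%:P).
    rewrite -(finField_genPoly F) cardF -cardK.
    have -> : 'X^#|K| - 'X = map_poly (in_alg FL) ('X^#|K| - 'X).
      by rewrite rmorphB /= map_polyXn map_polyX.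
    rewrite dvdp_map; apply: mdvd.
    rewrite /evK rmorphB rmorphXn /= horner_algX; apply/eqP; rewrite subr_eq0.
    by apply/eqP; exact: expf_card.
  case/dvdp_prod_XsubC => bs eqm.
  have szmF : size mF = n.+1 by rewrite size_map_poly -szm prednK.
  have u : uniq (mask bs (index_enum FL)) by rewrite mask_uniq // index_enum_uniq.
  have <- : size (mask bs (index_enum FL)) = n.
    by apply: succn_inj; rewrite -szmF (eqp_size eqm) size_prod_XsubC.
  rewrite -(card_uniqP u); apply: eq_card => w.
  by rewrite inE mFE -/(root mF w) (eqp_root eqm) root_prod_XsubC.
rewrite -cardW.
have ginj : {in [set f | is_field_hom f] &, injective (fun f : {ffun K -> F} => f z)}.
  move=> f g; rewrite !inE => fP gP fgz; apply/ffunP => x.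
  by have [h <-] := zP x; rewrite !field_hom_eval // fgz.
rewrite -(card_in_imset ginj); apply: eq_card => w.
apply/imsetP/idP => [[f]|].
  rewrite !inE => fP ->; rewrite -field_hom_eval // mz.
  case/is_field_homP: fP => _ fD _; apply/eqP.
  by apply: (addrI (f 0)); rewrite -fD !addr0.
rewrite inE => /eqP wm.
(* A root [w] yields the homomorphism that writes [x] as a polynomial in [z] and evaluates that
   polynomial at [w]; [wd] is independence of the polynomial chosen. *)
have [hx hxP] := choice zP.
have wd h1 h2 : evK z h1 = evK z h2 -> evF w h1 = evF w h2.
  move=> e; have /mdvd/dvdpP[q hq] : evK z (h1 - h2) = 0.
    by rewrite /evK rmorphB /= -!/(evK _ _) e subrr.
  apply/eqP; rewrite -subr_eq0 /evF -rmorphB hq rmorphM /= -!/(evF _ _) wm.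
  by rewrite mulr0.
pose f : {ffun K -> F} := [ffun x => evF w (hx x)].
exists f; last first.
  by rewrite ffunE (wd _ 'X) /evF ?horner_algX // hxP /evK horner_algX.
rewrite inE; apply/is_field_homP; split.
- by rewrite ffunE (wd _ 1) ?hxP ?/evF ?/evK ?rmorph1.
- move=> x y; rewrite !ffunE (wd _ (hx x + hx y)) ?hxP /evF ?rmorphD //.
  by rewrite /evK rmorphD /= -!/(evK _ _) !hxP.
- move=> x y; rewrite !ffunE (wd _ (hx x * hx y)) ?hxP /evF ?rmorphM //.
  by rewrite /evK rmorphM /= -!/(evK _ _) !hxP.
Qed.
End FiniteFieldHoms.

(** * Cardinals and ring isomorphisms *)

Lemma inj_surj_bij (T U : Type) (f : T -> U) :
  injective f -> (forall y, exists x, f x = y) -> bijective f.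
Proof.
by move=> f_inj /choice[g gK]; exists g => // x; apply: f_inj; rewrite gK.
Qed.

Lemma has_card_bij (T U : Type) (f : T -> U) m :
  bijective f -> has_card U m -> has_card T m.
Proof. by move=> fb [g gb]; exists (g \o f); apply: bij_comp. Qed.

Lemma has_card_uniq (T : Type) m n : has_card T m -> has_card T n -> m = n.
Proof.
case=> f [h hK fK] [g gb]; rewrite -[m]card_ord -[n]card_ord.
by apply: (bij_eq_card (f := g \o h)); apply: bij_comp => //; exists f.
Qed.

Lemma fcardE (T : Type) m : has_card T m -> Defs.fcard T = m.
Proof.
move=> Tm; apply: has_card_uniq (Tm).
by rewrite /Defs.fcard; apply: ClassicalEpsilon.epsilon_spec; exists m.
Qed.

Lemma fcardP (T : Type) : finite_type T -> has_card T (Defs.fcard T).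
Proof. by case=> m Tm; rewrite (fcardE Tm). Qed.

Lemma has_card_fin (T : finType) : has_card T #|T|.
Proof. by exists enum_rank; exists enum_val; [apply: enum_rankK|apply: enum_valK]. Qed.

Lemma has_card_prod (T U : Type) m n :
  has_card T m -> has_card U n -> has_card (T * U) (m * n).
Proof.
case=> f [f' fK f'K] [g [g' gK g'K]].
have := has_card_fin ('I_m * 'I_n)%type; rewrite card_prod !card_ord.
apply: (@has_card_bij _ _ (fun x => (f x.1, g x.2))).
by exists (fun x => (f' x.1, g' x.2)) => -[x y] /=; rewrite ?(fK, f'K, gK, g'K).
Qed.

Lemma has_card_sigma (I : finType) (T : I -> Type) (c : I -> nat) :
  (forall i, has_card (T i) (c i)) -> has_card {i & T i} (\sum_i c i).
Proof.
move=> Tc.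
pose f i : T i -> 'I_(c i) := sval (cid (Tc i)).
have fb i : bijective (f i) by rewrite /f; case: cid.
have := has_card_fin {i : I & 'I_(c i)}; rewrite card_tagged.
rewrite sumnE big_map big_enum /=.
have -> : (\sum_i #|'I_(c i)| = \sum_i c i)%N.
  by apply: eq_bigr => i _; rewrite card_ord.
apply: (@has_card_bij _ _ (fun x => Tagged (fun i => 'I_(c i)) (f (tag x) (tagged x)))).
have ex i : exists g, cancel (f i) g /\ cancel g (f i).
  by case: (fb i) => g gK hK; exists g.
pose g i := sval (cid (ex i)).
have gP i : cancel (f i) (g i) /\ cancel (g i) (f i) by rewrite /g; case: cid.
exists (fun x => existT T (tag x) (g (tag x) (tagged x))) => -[i x] /=.
  by rewrite (gP i).1.
by rewrite (gP i).2.
Qed.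

Lemma has_card0 (T : Type) : (T -> False) -> has_card T 0.
Proof.
move=> T0; exists (fun x => match T0 x with end); apply: inj_surj_bij.
  by move=> x; case: (T0 x).
by case.
Qed.

(** A predicate on bare functions: all rings [ring_of s] share the carrier ['I_N], so one map can be
    tested against several structures. *)
Definition riso (R S : comPzRingType) (f : R -> S) : Prop :=
  [/\ bijective f, {morph f : x y / x + y} & {morph f : x y / x * y}].

Section Iso.
Variables (R S : comPzRingType) (f : R -> S).
Hypothesis fP : riso f.

Lemma riso1 : f 1 = 1.
Proof.
case: fP => -[g fK gK] _ fM.
by rewrite -[LHS]mulr1 -[X in _ * X](gK 1) -fM mul1r gK.
Qed.

Lemma riso0 : f 0 = 0.
Proof. by case: fP => _ fD _; apply: (addrI (f 0)); rewrite -fD !addr0. Qed.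

Lemma riso_inv : exists2 g : S -> R, cancel f g /\ cancel g f & riso g.
Proof.
case: fP => -[g fK gK] fD fM; exists g => //; split; first by exists f.
- by move=> x y; rewrite -{1}(gK x) -{1}(gK y) -fD fK.
- by move=> x y; rewrite -{1}(gK x) -{1}(gK y) -fM fK.
Qed.

End Iso.

Lemma rmorph_exists (R S : pzRingType) (f : R -> S) : f 1 = 1 ->
  {morph f : x y / x + y} -> {morph f : x y / x * y} ->
  exists g : {rmorphism R -> S}, g =1 f.
Proof.
move=> f1 fD fM.
have fB : {morph f : x y / x - y}.
  by move=> x y; apply: (addIr (f y)); rewrite -fD !subrK.
pose fa := GRing.isZmodMorphism.Build R S f fB.
pose fm := GRing.isMonoidMorphism.Build R S f (conj f1 fM).
pose g : {rmorphism R -> S} := HB.pack f fa fm.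
by exists g.
Qed.

Section Functor.
Variable X : functor.

Lemma functor_iso (R S : comPzRingType) (f : R -> S) m :
  riso f -> has_card (X S) m -> has_card (X R) m.
Proof.
move=> fP; have [_ fD fM] := fP.
have [g [fK gK] gP] := riso_inv fP; have [_ gD gM] := gP.
have [f' f'E] := rmorph_exists (riso1 fP) fD fM.
have [g' g'E] := rmorph_exists (riso1 gP) gD gM.
apply: (has_card_bij (f := Fmap X f')); exists (Fmap X g') => a.
  rewrite -(@Fmap_comp X _ _ _ f' g' idfun) ?Fmap_id // => x.
  by rewrite g'E f'E fK.
rewrite -(@Fmap_comp X _ _ _ g' f' idfun) ?Fmap_id // => x.
by rewrite g'E f'E gK.
Qed.

Lemma functor_prod (R S : comPzRingType) m n : Defs.multiplicative X ->
  has_card (X R) m -> has_card (X S) n -> has_card (X (R * S)%type) (m * n).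
Proof.
by move=> [_ /(_ R S) XP] XR XS; apply: (has_card_bij XP); apply: has_card_prod.
Qed.

End Functor.

(** * Finite semisimple rings *)

(* [e] is the family of elements of [R] dual to the coordinate maps [phi]; it
   replaces the bijection onto the dependent product and makes reindexing free of casts. *)
Definition decomp (R : comPzRingType) (I : finType) (F : I -> finFieldType)
    (phi : forall i, {rmorphism R -> F i}) (e : I -> R) : Prop :=
  [/\ forall x, (forall i, phi i x = 0) -> x = 0,
      forall i j, phi i (e j) = (i == j)%:R
    & forall i y, exists x, phi i x = y].

Definition decomposable (R : comPzRingType) : Prop :=
  exists (I : finType) F phi e, @decomp R I F phi e.

(** From a product bijection, the [e j] are the preimages of the coordinate vectors. Conversely,
    sums of products [e j * s j] realize any prescribed family of coordinates. *)
Lemma finite_semisimpleP (R : comPzRingType) :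
  finite_semisimple R <-> decomposable R.
Proof.
split=> [[m [F [phi [phib phiD phiM phi1]]]]|[I [F [phi [e [phi_inj phie phis]]]]]].
  have ex i : exists g : {rmorphism R -> F i}, g =1 phi^~ i.
    by apply: rmorph_exists => [|x y|x y]; rewrite ?phi1 ?phiD ?phiM.
  pose psi i := sval (cid (ex i)).
  have psiE i : psi i =1 phi^~ i by rewrite /psi; case: cid.
  have [g phiK gK] := phib.
  exists 'I_m, F, psi, (fun j => g (fun i => (i == j)%:R)); split=> [x x0|i j|i y].
  - apply: (bij_inj phib); apply: functional_extensionality_dep => i.
    by rewrite -!psiE x0 rmorph0.
  - by rewrite psiE gK.
  - exists (g (dfwith (fun j => 0 : F j) y)).
    by rewrite psiE gK dfwith_in.
exists #|I|, (fun j => F (enum_val j)), (fun x j => phi (enum_val j) x).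
split=> [|x y j|x y j|j]; rewrite ?rmorphD ?rmorphM ?rmorph1 //.
apply: inj_surj_bij => [x y xy|y].
  apply/eqP; rewrite -subr_eq0; apply/eqP; apply: phi_inj => i.
  rewrite rmorphB -[i]enum_rankK.
  by have /= -> := congr1 (fun h => h (enum_rank i)) xy; rewrite subrr.
have ex j : exists x, phi (enum_val j) x = y j by apply: phis.
pose s j := sval (cid (ex j)).
have sE j : phi (enum_val j) (s j) = y j by rewrite /s; case: cid.
exists (\sum_j e (enum_val j) * s j); apply: functional_extensionality_dep => j.
rewrite rmorph_sum (bigD1 j) //= rmorphM phie eqxx mul1r sE big1 ?addr0 // => i ij.
rewrite rmorphM phie (inj_eq enum_val_inj) eq_sym.
by rewrite (negbTE ij) mul0r.
Qed.

(** * Primitive idempotents of a product of fields *)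

Definition primitive_idem (R : comPzRingType) (e : R) : Prop :=
  [/\ e * e = e, e <> 0 & forall f, f * f = f -> f * e = f -> f = 0 \/ f = e].

Lemma field_idem (F : fieldType) (u : F) : u * u = u -> u = 0 \/ u = 1.
Proof.
move=> uu; have [->|u0] := eqVneq u 0; [by left|right].
by apply: (mulfI u0); rewrite mulr1.
Qed.

Section Decomposition.
Variables (R : comPzRingType) (I : finType) (F : I -> finFieldType).
Variables (phi : forall i, {rmorphism R -> F i}) (e : I -> R).
Hypothesis RP : decomp phi e.

Lemma decomp_inj x y : (forall i, phi i x = phi i y) -> x = y.
Proof.
case: RP => phi_inj _ _ xy; apply/eqP; rewrite -subr_eq0; apply/eqP.
by apply: phi_inj => i; rewrite rmorphB xy subrr.
Qed.

Lemma decomp_dual i j : phi i (e j) = (i == j)%:R.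
Proof. by case: RP. Qed.

Lemma decomp_dual_inj : injective e.
Proof.
move=> i j ij; apply/eqP; have := decomp_dual i j.
by rewrite -ij decomp_dual eqxx; case: eqP => // _ /eqP; rewrite oner_eq0.
Qed.

(** An idempotent below [e i] vanishes at the other coordinates, and at [i] it is an idempotent of a
    field. *)
Lemma decomp_primitive i : primitive_idem (e i).
Proof.
split.
- apply: decomp_inj => j; rewrite rmorphM decomp_dual.
  by case: eqP => _; rewrite ?mulr1 ?mulr0.
- move=> ei0; have := decomp_dual i i; rewrite ei0 rmorph0 eqxx => /esym/eqP.
  by rewrite oner_eq0.
- move=> f ff fe.
  have fj j : j != i -> phi j f = 0.
    by move=> ji; rewrite -fe rmorphM decomp_dual (negbTE ji) mulr0.
  have : phi i f * phi i f = phi i f by rewrite -rmorphM ff.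
  case/field_idem => fi; [left|right]; apply: decomp_inj => j.
    by rewrite rmorph0; have [->|/fj] := eqVneq j i.
  by rewrite decomp_dual; have [->|/fj] := eqVneq j i.
Qed.

(** Some coordinate [i] of [f] is nonzero, hence 1; then [e i] lies below [f], and minimality of [f]
    forces equality. *)
Lemma primitive_decomp f : primitive_idem f -> exists i, f = e i.
Proof.
case=> ff f0 fmin.
have [i fi] : exists i, phi i f <> 0.
  apply: contrapT => /forallNP H; apply: f0; apply: decomp_inj => i.
  by rewrite rmorph0; apply: contrapT; apply: H.
have fi1 : phi i f = 1.
  have : phi i f * phi i f = phi i f by rewrite -rmorphM ff.
  by case/field_idem.
have [eiei ei0 _] := decomp_primitive i.
have ef : e i * f = e i.
  apply: decomp_inj => j; rewrite rmorphM decomp_dual.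
  by have [->|_] := eqVneq j i; rewrite ?fi1 ?mulr1 ?mul0r.
by exists i; case: (fmin (e i) eiei ef).
Qed.

End Decomposition.

(** * Ring structures on ['I_M] pulled back along an injection *)

Section Transport.
Variables (M : nat) (R : comPzRingType) (g : 'I_M -> R) (u : R).
Hypothesis (g_inj : injective g).
Let im x := exists i, g i = x.
Hypotheses (imD : forall x y, im x -> im y -> im (x + y)).
Hypotheses (imM : forall x y, im x -> im y -> im (x * y)).
Hypotheses (imN : forall x, im x -> im (- x)) (im0 : im 0) (imu : im u).
Hypothesis (mul1u : forall x, im x -> u * x = x).

(** The unit of the image is [u] rather than 1, so that the image may be a block such as [(1 - e) R]
    or the zero ring. *)
Lemma ring_str_transport :
  exists2 s : ring_str M, {morph (g : ring_of s -> R) : x y / x + y}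
    & {morph (g : ring_of s -> R) : x y / x * y}.
Proof.
have [z zE] := im0; have [o oE] := imu.
(* The default [z] is harmless: [h] is only applied to elements of the image. *)
pose h x : 'I_M := match pselect (im x) with left H => sval (cid H) | _ => z end.
have hK x : im x -> g (h x) = x.
  by rewrite /h; case: pselect => // H _; case: cid.
have gim i : im (g i) by exists i.
pose add i j := h (g i + g j); pose mul i j := h (g i * g j).
have gD i j : g (add i j) = g i + g j by apply: hK; apply: imD.
have gM i j : g (mul i j) = g i * g j by apply: hK; apply: imM.
have gN i : g (h (- g i)) = - g i by apply: hK; apply: imN.
have ax : exists d : 'I_M * 'I_M * ('I_M -> 'I_M), cring_axioms
    (fun x y => [ffun p : 'I_M * 'I_M => add p.1 p.2] (x, y))
    (fun x y => [ffun p : 'I_M * 'I_M => mul p.1 p.2] (x, y)) d.1.1 d.1.2 d.2.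
  exists (z, o, fun i => h (- g i)); split=> [x y t|x y|x|x|x y t|x y|x|x y t];
    rewrite /= !ffunE /=; apply: g_inj; rewrite ?(gD, gM, gN).
  - exact: addrA.
  - exact: addrC.
  - by rewrite zE add0r.
  - by rewrite zE addNr.
  - exact: mulrA.
  - exact: mulrC.
  - by rewrite oE mul1u.
  - exact: mulrDl.
exists (RingStr ax) => x y.
  by rewrite -gD; congr g; rewrite /GRing.add /= ffunE.
by rewrite -gM; congr g; rewrite /GRing.mul /= ffunE.
Qed.
End Transport.

(** * Closure properties of finite semisimple rings *)

Lemma decomposable_iso (R S : comPzRingType) (f : R -> S) :
  riso f -> decomposable S -> decomposable R.
Proof.
move=> fP [I [F [phi [e [phi_inj phie phis]]]]].
have [_ fD fM] := fP; have [g [fK gK] _] := riso_inv fP.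
have [h hE] := rmorph_exists (riso1 fP) fD fM.
exists I, F, (fun i => phi i \o h), (g \o e); split=> [x x0|i j|i y].
- have : h x = 0 by apply: phi_inj => i; apply: x0.
  by rewrite hE -(riso0 fP) => /(can_inj fK).
- by rewrite /= hE gK phie.
- by have [x <-] := phis i y; exists (g x); rewrite /= hE gK.
Qed.

Lemma decomposable_field (F : finFieldType) : decomposable F.
Proof.
exists unit, (fun=> F), (fun=> idfun), (fun=> 1); split=> [x /(_ tt)//|[] []//|_ y].
by exists y.
Qed.

Lemma decomposable0 (R : comPzRingType) : (1 : R) = 0 -> decomposable R.
Proof.
move=> R0; have all0 (x : R) : x = 0 by rewrite -[x]mulr1 R0 mulr0.
have [g _] : exists g : forall i : void, {rmorphism R -> 'F_2}, True.
  by exists (fun i : void => match i with end).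
by exists void, (fun=> 'F_2 : finFieldType), g, (fun=> 0); split=> [x _|[]|[]].
Qed.

Lemma decomposable_prod (R S : comPzRingType) :
  decomposable R -> decomposable S -> decomposable (R * S)%type.
Proof.
move=> [I [F [phi [e [phi_inj phie phis]]]]] [J [G [psi [d [psi_inj psid psis]]]]].
exists (I + J)%type, (fun k => match k with inl i => F i | inr j => G j end).
exists (fun k => match k return {rmorphism (R * S)%type ->
   (match k with inl i => F i | inr j => G j end : finFieldType)} with
   | inl i => phi i \o fst | inr j => psi j \o snd end).
exists (fun k => match k with inl i => (e i, 0) | inr j => (0, d j) end).
split=> [[x y] xy0|[i|j] [k|l]|[i|j] y] /=; rewrite ?phie ?psid ?rmorph0 //.
- congr (_, _); first by apply: phi_inj => i; apply: (xy0 (inl i)).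
  by apply: psi_inj => i; apply: (xy0 (inr i)).
- by have [x <-] := phis i y; exists (x, 0).
- by have [x <-] := psis j y; exists (0, x).
Qed.

(** Each coordinate map sends the idempotent [(0, 1)] to 0 or 1. Those with value 1 restrict to
    unital maps on [S]; the others vanish on the second factor, so the former decompose [S]. *)
Lemma decomposable_factor (R S : comPzRingType) :
  decomposable (R * S)%type -> decomposable S.
Proof.
move=> [I [F [phi [e [phi_inj phie phis]]]]].
pose A : comPzRingType := (R * S)%type.
pose v : A := (0, 1).
have vv : v * v = v by congr (_, _); rewrite ?mulr1 ?mulr0.
have vE (x : A) : v * x = (0, x.2) by congr (_, _); rewrite ?mul1r ?mul0r.
pose J := {i : I | phi i v == 1}.
have ex (j : J) : exists g : {rmorphism S -> F (val j)}, g =1 fun x => phi (val j) ((0, x) : A).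
  apply: rmorph_exists => [|x y|x y].
  - exact/eqP/(valP j).
  - by rewrite -rmorphD; congr (phi _ (_, _)); rewrite addr0.
  - by rewrite -rmorphM; congr (phi _ (_, _)); rewrite mulr0.
pose psi j := sval (cid (ex j)).
have psiE j : psi j =1 fun x => phi (val j) ((0, x) : A) by rewrite /psi; case: cid.
have psiv (j : J) (x : A) : psi j x.2 = phi (val j) x.
  by rewrite psiE -vE rmorphM (eqP (valP j)) mul1r.
exists J, (fun j => F (val j)), psi, (fun j => (e (val j)).2); split.
- move=> x x0; suff : ((0, x) : A) = 0 by case.
  apply: phi_inj => i; have : phi i v * phi i v = phi i v by rewrite -rmorphM vv.
  case/field_idem => iv; last first.
    have iJ : phi i v == 1 by apply/eqP.
    by have := x0 (exist _ i iJ); rewrite psiE.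
  by rewrite -(vE (0, x)) rmorphM iv mul0r.
- by move=> i j; rewrite psiv phie.
- by move=> j y; have [x <-] := phis (val j) y; exists x.2; rewrite psiv.
Qed.

(** * The finite type of ring structures on ['I_N], and block sizes *)

Section Structures.
Variable N : nat.

(** Zero, unit and opposites live inside the existential [rax], so proof irrelevance suffices. *)
Lemma ring_str_ext (s t : ring_str N) : radd s = radd t -> rmul s = rmul t -> s = t.
Proof.
case: s t => [a m sP] [b k tP] /= ab mk; move: sP tP; rewrite ab mk => sP tP.
by rewrite (Prop_irrelevance sP tP).
Qed.

Lemma riso_str_uniq (R : comPzRingType) (g : R -> 'I_N) (s t : ring_str N) :
  riso (g : R -> ring_of s) -> riso (g : R -> ring_of t) -> s = t.
Proof.
move=> [[h hK gK] sD sM] [_ tD tM]; apply: ring_str_ext; apply/ffunP => -[x y].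
  rewrite -(gK x) -(gK y).
  by transitivity (g (h x + h y)); [rewrite sD|rewrite tD].
rewrite -(gK x) -(gK y).
by transitivity (g (h x * h y)); [rewrite sM|rewrite tM].
Qed.

Lemma ring_str_of_bij (R : comPzRingType) (g : R -> 'I_N) : bijective g ->
  exists s : ring_str N, riso (g : R -> ring_of s).
Proof.
case=> h gK hK.
have im x : exists i, h i = x by exists (g x); rewrite gK.
have [s sD sM] := ring_str_transport (can_inj hK) (fun x y _ _ => im (x + y))
  (fun x y _ _ => im (x * y)) (fun x _ => im (- x)) (im 0) (im 1)
  (fun x _ => mul1r x).
exists s; split; first by exists h.
- by move=> x y; apply: (can_inj hK); rewrite sD !gK.
- by move=> x y; apply: (can_inj hK); rewrite sM !gK.
Qed.

(** This injection into pairs of tables makes [ring_str N] a finite type, over which sums can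
    run. *)
Definition str_tables (s : ring_str N) := (radd s, rmul s).

Lemma str_tables_inj : injective str_tables.
Proof. by move=> s t [] /ring_str_ext/[apply]. Qed.

Definition str_of_tables t : option (ring_str N) :=
  match pselect (exists s, str_tables s = t) with
  | left H => Some (sval (cid H)) | right _ => None end.

Lemma str_tablesK : pcancel str_tables str_of_tables.
Proof.
move=> s; rewrite /str_of_tables; case: pselect => [H|[]]; last by exists s.
by congr Some; apply: str_tables_inj; case: cid.
Qed.

HB.instance Definition _ := Finite.copy (ring_str N) (pcan_type str_tablesK).

(** For an idempotent [e], the fixed points of multiplication by [e] form the block [e R]. *)
Definition block_size (s : ring_str N) (e : ring_of s) : nat :=
  #|[set x : 'I_N | e * (x : ring_of s) == x]|.

Variables (s : ring_str N) (I : finType) (F : I -> finFieldType).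
Variables (phi : forall i, {rmorphism ring_of s -> F i}) (e : I -> ring_of s).
Hypothesis sP : decomp phi e.

Lemma card_decomp : N = (\prod_i #|F i|)%N.
Proof.
pose h (x : 'I_N) : {dffun forall i, F i} := [ffun i => phi i x].
have hb : bijective h.
  apply: inj_surj_bij => [x y|y].
    move/ffunP => xy; apply: (decomp_inj sP) => i.
    by have := xy i; rewrite !ffunE.
  have [_ _ phis] := sP.
  pose t i := sval (cid (phis i (y i))).
  have tE i : phi i (t i) = y i by rewrite /t; case: cid.
  exists (\sum_i e i * t i); apply/ffunP => i; rewrite ffunE rmorph_sum (bigD1 i) //=.
  rewrite rmorphM (decomp_dual sP) eqxx mul1r tE big1 ?addr0 // => j ji.
  by rewrite rmorphM (decomp_dual sP) eq_sym (negbTE ji) mul0r.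
rewrite -[LHS]card_ord (bij_eq_card hb) card_dep_ffun foldrE big_map.
by rewrite big_enum.
Qed.

(** Multiplication by [e i] kills every coordinate but the [i]-th, so [phi i] maps the block
    bijectively onto [F i]. *)
Lemma block_size_dual i : block_size (e i) = #|F i|.
Proof.
rewrite /block_size; set B := [set _ | _].
have phi_inj : {in B &, injective (phi i : 'I_N -> F i)}.
  move=> x y; rewrite !inE => /eqP xE /eqP yE xy; rewrite -xE -yE.
  apply: (decomp_inj sP) => j; rewrite !rmorphM (decomp_dual sP).
  by case: eqP => [->|_]; rewrite ?xy ?mul0r.
rewrite -(card_in_imset phi_inj); apply: eq_card => y; rewrite [RHS]inE.
have [_ _ phis] := sP; have [x xy] := phis i y.
apply/imsetP; exists (e i * x).
  by rewrite inE mulrA; case: (decomp_primitive sP i) => ->.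
by rewrite rmorphM (decomp_dual sP) eqxx mul1r xy.
Qed.

Lemma sum_block_size (w : nat -> rat) :
  (forall a b, (0 < a)%N -> (0 < b)%N -> w (a * b)%N = w a + w b) ->
  \sum_(f : 'I_N | `[< primitive_idem (f : ring_of s) >])
     w (block_size (f : ring_of s)) = w N.
Proof.
move=> wM; transitivity (\sum_i w #|F i|); last first.
  rewrite card_decomp.
  (* Positivity is carried through the induction because [w] is additive only on positive
     arguments. *)
  have : (0 < \prod_i #|F i|)%N /\ \sum_i w #|F i| = w (\prod_i #|F i|)%N.
    elim/big_rec2: _ => [|i a b _ [a0 ->]].
      by split=> //; apply: (addrI (w 1%N)); rewrite addr0 -wM.
    have F0 : (0 < #|F i|)%N by rewrite (cardD1 0).
    by rewrite muln_gt0 F0 a0 wM.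
  by case.
transitivity (\sum_(f in [set (e i : 'I_N) | i : I]) w (block_size (f : ring_of s))).
  apply: eq_bigl => f; apply/asboolP/imsetP => [|[i _ ->]].
    by case/(primitive_decomp sP) => i ->; exists i.
  exact: (decomp_primitive sP).
rewrite big_imset /=; last by move=> i j _ _; apply: (decomp_dual_inj sP).
by apply: eq_bigr => i _; rewrite block_size_dual.
Qed.

End Structures.

(** * Splitting off a field *)

(** A relation, so that the same quadruples can be counted from [(s, e)] or from [(b, t)]. *)
Definition splits (N M : nat) (F : finFieldType) (b : {ffun 'I_N -> F * 'I_M})
    (s : ring_str N) (t : ring_str M) (e : 'I_N) : Prop :=
  riso (b : ring_of s -> (F * ring_of t)%type) /\ b e = (1, 0 : ring_of t).

Section Split.
Variables (N M : nat) (F : finFieldType).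
Variables (s : ring_str N) (t : ring_str M) (b : {ffun 'I_N -> F * 'I_M}) (e : 'I_N).
Hypothesis bP : splits b s t e.

Lemma splits_inj : injective b.
Proof. by case: bP => [[/bij_inj]]. Qed.

Lemma splits_mulr (x : ring_of s) : b ((e : ring_of s) * x) = ((b x).1, 0 : ring_of t).
Proof.
case: bP => [[_ _ bM] be].
transitivity ((b e : (F * ring_of t)%type) * b x); first exact: bM.
by rewrite be; congr (_, _); rewrite /= ?mul1r ?mul0r.
Qed.

(** Through [b], an idempotent below [e] becomes [(u, 0)] with [u] an idempotent of the field
    [F]. *)
Lemma splits_primitive : primitive_idem (e : ring_of s).
Proof.
have [br be] := bP; have [_ _ bM] := br.
split.
- by apply: splits_inj; rewrite splits_mulr be.
- move=> e0; have := be; rewrite e0.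
  have -> : b (0 : ring_of s) = (0 : F, 0 : ring_of t) by exact: (riso0 br).
  by case=> /eqP; rewrite eq_sym oner_eq0.
move=> f ff fe; have bf : b f = ((b f).1, 0 : ring_of t).
  by rewrite -[in LHS]fe mulrC splits_mulr.
have : (b f).1 * (b f).1 = (b f).1.
  by have := bM f f; rewrite ff => /(congr1 fst)/esym.
case/field_idem => f1; [left|right]; apply: splits_inj.
  by rewrite bf f1; apply/esym; exact: (riso0 br).
by rewrite bf f1 be.
Qed.

Lemma splits_block_size : block_size (e : ring_of s) = #|F|.
Proof.
have [br be] := bP; have [[h bK hK] _ _] := br.
rewrite /block_size; set B := [set _ | _].
have BP x : x \in B -> b x = ((b x).1, 0 : ring_of t).
  by rewrite inE => /eqP ex; rewrite -[in LHS]ex splits_mulr.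
have b_inj : {in B &, injective (fun x => (b x).1)}.
  by move=> x y /BP bx /BP byE xy; apply: splits_inj; rewrite bx byE xy.
rewrite -(card_in_imset b_inj); apply: eq_card => y; rewrite [RHS]inE.
apply/imsetP; exists (h (y, 0 : ring_of t)); last by rewrite hK.
rewrite inE; apply/eqP; apply: splits_inj.
by rewrite splits_mulr hK.
Qed.

Lemma splits_decomposable : decomposable (ring_of s) <-> decomposable (ring_of t).
Proof.
have [br _] := bP; split=> [sd|td].
  have [g _ gP] := riso_inv br.
  exact: decomposable_factor (decomposable_iso gP sd).
exact: decomposable_iso br (decomposable_prod (decomposable_field F) td).
Qed.

End Split.

Lemma splits_exists (N M : nat) (F : finFieldType) (b : {ffun 'I_N -> F * 'I_M})
    (t : ring_str M) : bijective b -> exists s e, splits b s t e.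
Proof.
case=> h bK hK.
have hb : bijective (h : (F * ring_of t)%type -> 'I_N) by exists b.
have [s sP] := ring_str_of_bij hb.
have [b' [hK' bK'] b'P] := riso_inv sP.
exists s, (h (1, 0 : ring_of t)); split; last exact: hK.
(* [riso_inv] provides some inverse of [h]; uniqueness of inverses identifies it with [b]. *)
have -> : (b : ring_of s -> (F * ring_of t)%type) = b' => //.
by apply: funext => x; rewrite -[RHS](hK (b' x)); congr (b _); rewrite (bK' x).
Qed.

Lemma splits_uniq (N M : nat) (F : finFieldType) (b : {ffun 'I_N -> F * 'I_M})
    (t : ring_str M) s1 s2 e1 e2 : splits b s1 t e1 -> splits b s2 t e2 ->
  (s1, e1) = (s2, e2).
Proof.
move=> b1 b2; have e12 : e1 = e2.
  by apply: (splits_inj b1); rewrite (proj2 b1) (proj2 b2).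
have [h1 [b1K h1K] h1P] := riso_inv (proj1 b1).
have [h2 [b2K h2K] h2P] := riso_inv (proj1 b2).
have hh : h2 = h1 :> ((F * ring_of t)%type -> 'I_N).
  by apply: funext => x; apply: (splits_inj b1); rewrite [LHS]h2K [RHS]h1K.
rewrite e12; congr (_, _); apply: (riso_str_uniq h1P).
by rewrite -hh.
Qed.

(* The witness is [x |-> (phi i x, (1 - e i) * x)]. *)
Lemma decomp_splits (N M : nat) (s : ring_str N) (I : finType) (F : I -> finFieldType)
    (phi : forall i, {rmorphism ring_of s -> F i}) (e : I -> ring_of s) (i : I) :
  decomp phi e -> (N = #|F i| * M)%N ->
  exists (b : {ffun 'I_N -> F i * 'I_M}) (t : ring_str M), splits b s t (e i).
Proof.
move=> sP NM.
(* The complementary block, described as the annihilator of [e i]; its unit is [u] below. *)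
pose Z := [set x : 'I_N | e i * (x : ring_of s) == 0].
have ee : e i * e i = e i by case: (decomp_primitive sP i).
pose u : ring_of s := 1 - e i.
have Zu (x : ring_of s) : (u * x : 'I_N) \in Z.
  by rewrite inE mulrA mulrBr mulr1 ee subrr mul0r.
have uZ (x : ring_of s) : (x : 'I_N) \in Z -> u * x = x.
  by rewrite inE mulrBl mul1r => /eqP->; rewrite subr0.
pose g (k : 'I_#|Z|) : ring_of s := enum_val k.
have g_inj : injective g by apply: enum_val_inj.
have gP x : (exists k, g k = x) <-> (x : 'I_N) \in Z.
  split=> [[k <-]|xZ]; first exact: enum_valP.
  by exists (enum_rank_in xZ x); apply: enum_rankK_in.
have [||||||t tD tM] := @ring_str_transport _ _ g u g_inj.
- move=> x y; rewrite !gP !inE => /eqP xZ /eqP yZ.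
  by rewrite mulrDr xZ yZ addr0.
- by move=> x y; rewrite !gP !inE => /eqP xZ _; rewrite mulrA xZ mul0r.
- by move=> x; rewrite !gP !inE => /eqP xZ; rewrite mulrN xZ oppr0.
- by rewrite gP inE mulr0.
- by rewrite gP -[u]mulr1 Zu.
- by move=> x /gP/uZ.
pose h (x : ring_of s) : 'I_#|Z| := enum_rank_in (Zu x) (u * x).
have hE x : g (h x) = u * x by apply: enum_rankK_in; apply: Zu.
have phiu (j : I) : phi j u = (j != i)%:R.
  by rewrite rmorphB rmorph1 (decomp_dual sP); case: eqP; rewrite ?subrr ?subr0.
pose b : {ffun 'I_N -> F i * 'I_#|Z|} := [ffun x : 'I_N => (phi i x, h x)].
have bb : bijective b.
  apply: inj_surj_bij => [x y|[y k]].
    rewrite !ffunE => -[xyi xyh]; apply: (decomp_inj sP) => j.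
    have [-> //|ji] := eqVneq j i.
    have := congr1 (fun k => phi j (g k)) xyh.
    by rewrite /= !hE !rmorphM phiu ji !mul1r.
  have [_ _ /(_ i y)[x xy]] := sP.
  have kZ : (g k : 'I_N) \in Z by apply: enum_valP.
  exists (e i * x + g k : ring_of s); rewrite ffunE; congr (_, _).
    rewrite rmorphD rmorphM (decomp_dual sP) eqxx mul1r xy -(uZ _ kZ) rmorphM.
    by rewrite phiu eqxx mul0r addr0.
  apply: g_inj; rewrite hE mulrDr (uZ (g k)) // mulrA mulrBl mul1r ee subrr mul0r.
  by rewrite add0r.
(* The complement was labelled by ['I_#|Z|]; comparing cardinalities through [b] gives [M], and the
   types of [b] and [t] are rewritten at the end. *)
have ZM : #|Z| = M.
  have := bij_eq_card bb; rewrite card_prod !card_ord {1}NM => /eqP.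
  by rewrite eqn_pmul2l => [/eqP|]; last by rewrite (cardD1 0).
have bS : splits b s t (e i).
  split; last first.
    rewrite ffunE (decomp_dual sP) eqxx; congr (_, _).
    apply: g_inj; rewrite hE mulrBl mul1r ee subrr.
    by apply: (addrI (g (0 : ring_of t))); rewrite -tD !addr0.
  split=> // x y; rewrite !ffunE; congr (_, _); rewrite ?rmorphD ?rmorphM //.
    by apply: g_inj; rewrite tD !hE mulrDr.
  apply: g_inj; rewrite tM !hE mulrACA; congr (_ * _).
  by rewrite -[in LHS](uZ u) // -[u]mulr1 Zu.
clear -bS ZM; move: b t bS; rewrite ZM => b t bS; by exists b, t.
Qed.

Lemma field_hom_bij (K F : finFieldType) (f : {ffun K -> F}) :
  #|K| = #|F| -> is_field_hom f -> bijective f.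
Proof.
move=> KF /is_field_homP[f1 fD fM]; apply: inj_card_bij; last by rewrite KF.
have [g gE] := rmorph_exists f1 fD fM.
by move=> x y; rewrite -!gE => /fmorph_inj.
Qed.

(* Once one splitting through [K] is fixed, every other one differs from it by an isomorphism
   [K -> F] and a relabelling of the complementary factor. *)
Lemma card_splits_aux (p n N M : nat) (K F : finFieldType) (s : ring_str N)
    (e : 'I_N) (b0 : {ffun 'I_N -> K * 'I_M}) (t0 : ring_str M) :
  prime p -> #|K| = (p ^ n)%N -> #|F| = (p ^ n)%N -> splits b0 s t0 e ->
  #|[set q : {ffun 'I_N -> F * 'I_M} * ring_str M | `[< splits q.1 s q.2 e >]]|
  = (n * M`!)%N.
Proof.
move=> p_pr cK cF b0P; have [b0r b0e] := b0P; have [[h0 b0K h0K] b0D b0M] := b0r.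
have ex (pi : {perm 'I_M}) : exists t : ring_str M, riso (pi : ring_of t0 -> ring_of t).
  apply: (@ring_str_of_bij M (ring_of t0) pi).
  by exists (pi^-1)%g; [apply: permK | apply: permKV].
pose tr pi := sval (cid (ex pi)).
have trP (pi : {perm 'I_M}) : riso (pi : ring_of t0 -> ring_of (tr pi)).
  by rewrite /tr; case: cid.
(* A pair [(f, pi)] acts on the two components of [b0], the structure on the complement being
   carried along [pi]. The image of this injection is the set to be counted. *)
pose Psi (q : {ffun K -> F} * {perm 'I_M}) :=
  ([ffun x => (q.1 (b0 x).1, q.2 (b0 x).2)] : {ffun 'I_N -> F * 'I_M}, tr q.2).
have Psi_inj : injective Psi.
  move=> [f pi] [g ro] [] /ffunP fg _; congr (_, _).
    apply/ffunP => k; have := fg (h0 (k, 0 : ring_of t0)).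
    by rewrite !ffunE h0K => -[].
  apply/permP => k; have := fg (h0 (0, k)).
  by rewrite !ffunE h0K => -[].
rewrite -(card_field_hom p_pr cK cF) -card_Sn -cardsT -cardsX.
rewrite -(card_imset _ Psi_inj); apply: eq_card => -[b t]; rewrite inE /=.
apply/asboolP/imsetP => [bP|[[f pi]]]; last first.
  rewrite !inE andbT /= => fH [-> ->].
  have [f1 fD fM] := is_field_homP _ fH; have fb := field_hom_bij (etrans cK (esym cF)) fH.
  have pP := trP pi; have [_ pD pM] := pP.
  split; last first.
    by rewrite ffunE b0e f1; congr (_, _); exact: (riso0 pP).
  split.
  - have [f' fK f'K] := fb.
    exists (fun y => h0 (f' y.1, (pi^-1)%g y.2)) => [x|[y k]]; rewrite ffunE /=.
      by rewrite fK permK; case: (b0 x) (b0K x).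
    by rewrite h0K /= f'K permKV.
  - move=> x y; rewrite !ffunE; congr (_, _).
      by rewrite -fD; congr (f _); rewrite b0D.
    by rewrite -[RHS]pD; congr (pi _); rewrite b0D.
  move=> x y; rewrite !ffunE; congr (_, _).
    by rewrite -fM; congr (f _); rewrite b0M.
  by rewrite -[RHS]pM; congr (pi _); rewrite b0M.
have [br be] := bP; have [[h bK hK] bD bM] := br.
(* For the converse, [b] after [h0] sends [(1, 0)] to [(1, 0)], hence respects the ideal it
   generates and its annihilator, and so is a product of maps [f] and [g]. *)
pose f : {ffun K -> F} := [ffun k => (b (h0 (k, 0 : ring_of t0))).1].
pose g (k : 'I_M) := (b (h0 (0 : K, k))).2.
have b_fst (k : K) : b (h0 (k, 0 : ring_of t0)) = (f k, 0 : ring_of t).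
  rewrite ffunE -(splits_mulr bP); congr (b _); apply: (splits_inj b0P).
  by rewrite (splits_mulr b0P) h0K.
have b_snd (k : 'I_M) : b (h0 (0 : K, k)) = (0 : F, g k).
  rewrite /g; suff : (b (h0 (0 : K, k))).1 = 0 by case: (b _) => x y /= ->.
  have := splits_mulr bP (h0 (0 : K, k)).
  have -> : (e : ring_of s) * h0 (0 : K, k) = 0.
    apply: (splits_inj b0P); rewrite (splits_mulr b0P) h0K.
    by apply/esym; exact: (riso0 b0r).
  have -> : b (0 : ring_of s) = (0 : F, 0 : ring_of t) by exact: (riso0 br).
  by case.
have h0D (x y : (K * ring_of t0)%type) : h0 (x + y) = (h0 x : ring_of s) + h0 y.
  by apply: (splits_inj b0P); rewrite h0K [RHS]b0D !h0K.
have h0M (x y : (K * ring_of t0)%type) : h0 (x * y) = (h0 x : ring_of s) * h0 y.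
  by apply: (splits_inj b0P); rewrite h0K [RHS]b0M !h0K.
have bE x : b x = (f (b0 x).1, g (b0 x).2).
  transitivity ((b (h0 ((b0 x).1, 0 : ring_of t0)) : (F * ring_of t)%type) +
                b (h0 (0 : K, (b0 x).2))).
    rewrite -bD -h0D; congr (b _); apply: (splits_inj b0P); rewrite h0K.
    by case: (b0 x) => k l; congr (_, _); rewrite /= ?addr0 ?add0r.
  by rewrite b_fst b_snd; congr (_, _); rewrite /= ?addr0 ?add0r.
have fH : is_field_hom f.
  apply/is_field_homP; split=> [|k l|k l].
  - have : b e = (1, 0 : ring_of t) := be.
    by rewrite bE b0e => -[].
  - have := bD (h0 (k, 0 : ring_of t0)) (h0 (l, 0 : ring_of t0)).
    rewrite -h0D.
    have -> : ((k, 0) : (K * ring_of t0)%type) + (l, 0) = (k + l, 0).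
      by congr (_, _); rewrite addr0.
    by rewrite !b_fst => -[].
  have := bM (h0 (k, 0 : ring_of t0)) (h0 (l, 0 : ring_of t0)).
  rewrite -h0M.
  have -> : ((k, 0) : (K * ring_of t0)%type) * (l, 0) = (k * l, 0).
    by congr (_, _); rewrite mulr0.
  by rewrite !b_fst => -[].
have g_inj : injective g.
  move=> k l kl; have : b (h0 (0 : K, k)) = b (h0 (0 : K, l)) by rewrite !b_snd kl.
  by move/(splits_inj bP)/(can_inj h0K) => -[].
pose pi := perm g_inj.
have gr : riso (pi : ring_of t0 -> ring_of t).
  split; first by exists (pi^-1)%g; [apply: permK | apply: permKV].
  - move=> k l; rewrite !permE.
    have := bD (h0 (0 : K, k)) (h0 (0 : K, l)); rewrite -h0D.
    have -> : ((0, k) : (K * ring_of t0)%type) + (0, l) = (0, (k : ring_of t0) + l).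
      by congr (_, _); rewrite addr0.
    by rewrite !b_snd => -[].
  move=> k l; rewrite !permE.
  have := bM (h0 (0 : K, k)) (h0 (0 : K, l)); rewrite -h0M.
  have -> : ((0, k) : (K * ring_of t0)%type) * (0, l) = (0, (k : ring_of t0) * l).
    by congr (_, _); rewrite mulr0.
  by rewrite !b_snd => -[].
exists (f, pi); first by rewrite !inE fH.
congr (_, _); last exact: riso_str_uniq gr (trP pi).
by apply/ffunP => x; rewrite bE [RHS]ffunE /= permE.
Qed.

(** The field factor of [s] selected by [e] supplies the reference splitting. *)
Lemma card_splits (p n N M : nat) (F : finFieldType) (s : ring_str N) (e : 'I_N) :
  prime p -> #|F| = (p ^ n)%N -> N = (p ^ n * M)%N ->
  decomposable (ring_of s) -> primitive_idem (e : ring_of s) ->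
  block_size (e : ring_of s) = (p ^ n)%N ->
  #|[set q : {ffun 'I_N -> F * 'I_M} * ring_str M | `[< splits q.1 s q.2 e >]]|
  = (n * M`!)%N.
Proof.
move=> p_pr cF NE [I [G [phi [d sP]]]] /(primitive_decomp sP)[i ->].
rewrite (block_size_dual sP) => cG.
have [|b [t bP]] := decomp_splits (i := i) (M := M) sP; first by rewrite cG.
exact: card_splits_aux p_pr cG cF bP.
Qed.

(** * Counting the zeta species *)

Lemma card_Fpn p n : prime p -> (0 < n)%N -> #|Fpn p n| = (p ^ n)%N.
Proof.
move=> p_pr n0; rewrite /Fpn.
case: Sumbool.sumbool_of_bool => [hp|]; last by rewrite p_pr.
case: Sumbool.sumbool_of_bool => [hn|]; last by rewrite n0.
by case: pPrimePowerField.
Qed.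

Lemma card_field_ppow (F : finFieldType) :
  exists p n, [/\ prime p, (0 < n)%N & #|F| = (p ^ n)%N].
Proof.
have [p p_pr pF] := finPcharP F.
have cF : #|F| = (p ^ logn p #|F|)%N := card_pprimeChar pF.
exists p, (logn p #|F|); split=> //; rewrite lt0n; apply: contraTneq (finNzRing_gt1 F).
by rewrite {2}cF => ->.
Qed.

(** This agrees with Omega for [0 < n <= K], as [logn p n] is 0 when [p] is not prime; the
    truncation keeps it a finite sum, additive at all positive arguments. *)
Definition prime_weight (K n : nat) : nat := (\sum_(p < K.+1) logn p n)%N.

Lemma prime_weightM K a b : (0 < a)%N -> (0 < b)%N ->
  prime_weight K (a * b) = (prime_weight K a + prime_weight K b)%N.
Proof.
by move=> a0 b0; rewrite -big_split; apply: eq_bigr => p _; rewrite lognM.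
Qed.

Lemma prime_weight_gt0 K n : (1 < n <= K)%N -> (0 < prime_weight K n)%N.
Proof.
case/andP=> n1 nK; have pK : (pdiv n < K.+1)%N.
  by rewrite ltnS (leq_trans _ nK) // pdiv_leq // ltnW.
rewrite /prime_weight (bigD1 (Ordinal pK)) //= addn_gt0 logn_gt0 mem_primes.
by rewrite pdiv_prime // pdiv_dvd ltnW.
Qed.

Section Species.
Variable X : functor.
Hypotheses (X_tame : tame X) (X_mult : Defs.multiplicative X).

(** Extension by zero lets sums run over all ring structures instead of the semisimple ones. *)
Definition weight N (s : ring_str N) : nat :=
  if `[< decomposable (ring_of s) >] then Defs.fcard (X (ring_of s)) else 0%N.

Lemma decomposable_card (R : comPzRingType) :
  decomposable R -> has_card (X R) (Defs.fcard (X R)).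
Proof. by move=> Rd; apply: fcardP; apply: X_tame; apply/finite_semisimpleP. Qed.

Lemma has_card_zeta N : has_card (zeta_species X N) (\sum_(s : ring_str N) weight s).
Proof.
(* The semisimplicity proof moves from the base to the fibre, so that the base is a finite type; the
   fibre is empty when [s] is not semisimple. *)
pose T (s : ring_str N) := {x : X (ring_of s) | finite_semisimple (ring_of s)}.
have Tc s : has_card (T s) (weight s).
  rewrite /weight; case: asboolP => [sd|nsd]; last first.
    by apply: has_card0 => -[_] /finite_semisimpleP.
  apply: (has_card_bij (f := sval)) (decomposable_card sd).
  have ss : finite_semisimple (ring_of s) by apply/finite_semisimpleP.
  by exists (fun x => exist _ x ss) => // -[x h]; rewrite (Prop_irrelevance h ss).
pose f (u : zeta_species X N) : {s : ring_str N & T s} :=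
  existT T (sval (tag u)) (exist _ (tagged u) (proj2_sig (tag u))).
apply: (has_card_bij (f := f)); last exact: has_card_sigma.
exists (fun v : {s : ring_str N & T s} =>
  existT (fun s : {s : ring_str N | finite_semisimple (ring_of s)} => X (ring_of (sval s)))
    (exist _ (tag v) (proj2_sig (tagged v))) (sval (tagged v))).
  by move=> [[s h] x].
by case=> s [x h].
Qed.

(** Multiplicativity of [X] handles the semisimple case; otherwise both weights vanish, since [s] is
    decomposable exactly when [t] is. *)
Lemma weight_splits (N M : nat) (F : finFieldType) (b : {ffun 'I_N -> F * 'I_M})
    (s : ring_str N) (t : ring_str M) e :
  splits b s t e -> weight s = (Defs.fcard (X F) * weight t)%N.
Proof.
move=> bP; rewrite /weight.
have [std tsd] := splits_decomposable bP.
case: asboolP => [sd|nsd]; case: asboolP => [td|ntd]; last by rewrite muln0.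
- apply: fcardE; apply: (functor_iso (proj1 bP)).
  apply: functor_prod => //; last exact: decomposable_card.
  exact/decomposable_card/decomposable_field.
- by case: ntd; apply: std.
- by case: nsd; apply: tsd.
Qed.

Definition block_count N d : nat := \sum_(s : ring_str N) weight s *
  #|[set e : 'I_N | `[< primitive_idem (e : ring_of s) >] &&
                    (block_size (e : ring_of s) == d)]|.

(** Quadruples with [splits b s t e], weighted by [weight s], are counted twice. For decomposable
    [s], [card_splits] counts the pairs [(b, t)] when [e] is primitive of block size [p ^ n], and
    other [e] admit none; a pair [(b, t)] with [b] bijective admits exactly one [(s, e)]. *)
Lemma block_countP (p n N M : nat) (F : finFieldType) :
  prime p -> #|F| = (p ^ n)%N -> N = (p ^ n * M)%N ->
  (block_count N (p ^ n) * (n * M`!) =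
   N`! * (Defs.fcard (X F) * \sum_(t : ring_str M) weight t))%N.
Proof.
move=> p_pr cF NE.
pose sp (b : {ffun 'I_N -> F * 'I_M}) (s : ring_str N) t e := `[< splits b s t e >].
transitivity (\sum_(s : ring_str N) \sum_(e : 'I_N) \sum_(b : {ffun 'I_N -> F * 'I_M})
   \sum_(t : ring_str M) sp b s t e * weight s)%N.
  rewrite /block_count big_distrl; apply: eq_bigr => s _ /=.
  rewrite -sum1_card big_distrr big_distrl big_mkcond /=; apply: eq_bigr => e _.
  rewrite pair_big -big_distrl /= inE muln1.
  have -> : (\sum_(q : {ffun 'I_N -> F * 'I_M} * ring_str M) sp q.1 s q.2 e =
     #|[set q : {ffun 'I_N -> F * 'I_M} * ring_str M | `[< splits q.1 s q.2 e >]]|)%N.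
    rewrite -sum1_card [RHS]big_mkcond; apply: eq_bigr => q _.
    by rewrite inE /sp; case: asbool.
  have [w0|w0] := eqVneq (weight s) 0%N; first by rewrite w0 muln0; case: ifP.
  have sd : decomposable (ring_of s) by move: w0; rewrite /weight; case: asboolP.
  case: ifP => [/andP[/asboolP ep /eqP es]|ne].
    by rewrite (card_splits p_pr cF NE) // mulnC.
  rewrite (_ : [set _ | _] = set0) ?cards0 //; apply/setP => q; rewrite !inE.
  apply/asboolP => qP; move: ne.
  rewrite (splits_block_size qP) cF eqxx andbT => /asboolP; apply.
  exact: (splits_primitive qP).
transitivity (\sum_(b : {ffun 'I_N -> F * 'I_M}) \sum_(t : ring_str M)
   injectiveb b * (Defs.fcard (X F) * weight t))%N; last first.
  (* Injections between two sets of size [N] are counted by the falling factorial [N ^_ N]. *)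
  rewrite -[in N`!](ffactnn N).
  have := card_inj_ffuns 'I_N (F * 'I_M)%type.
  rewrite card_prod !card_ord cF -NE => <-.
  rewrite -sum1_card big_distrl [RHS]big_mkcond; apply: eq_bigr => b _ /=.
  rewrite inE -big_distrr /= mul1n.
  by case: injectiveb; rewrite ?mul1n ?mul0n // big_distrr.
transitivity (\sum_(b : {ffun 'I_N -> F * 'I_M}) \sum_(t : ring_str M)
   \sum_(s : ring_str N) \sum_(e : 'I_N) sp b s t e * weight s)%N.
  under eq_bigr do rewrite exchange_big.
  rewrite exchange_big; apply: eq_bigr => b _.
  under eq_bigr do rewrite exchange_big.
  by rewrite exchange_big.
apply: eq_bigr => b _; apply: eq_bigr => t _.
case: injectiveP => [b_inj|nb]; last first.
  rewrite mul0n big1 // => s _; rewrite big1 // => e _.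
  by rewrite /sp; case: asboolP => // /splits_inj.
have bb : bijective b.
  by apply: inj_card_bij => //; rewrite card_prod !card_ord cF -NE.
have [s [e bP]] := splits_exists t bb.
rewrite (bigD1 s) //= (bigD1 e) //= !big1 ?addn0.
- by rewrite /sp asboolT //= !mul1n; exact: (weight_splits bP).
- move=> s' ss'; rewrite big1 // => e' _; rewrite /sp; case: asboolP => // bP'.
  by have [ss _] := splits_uniq bP bP'; rewrite ss eqxx in ss'.
move=> e' ee'; rewrite /sp; case: asboolP => // bP'.
by have [ee] := splits_uniq bP bP'; rewrite ee eqxx in ee'.
Qed.

End Species.

Lemma ring_str1_uniq (s t : ring_str 1) : s = t.
Proof. by apply: ring_str_ext; apply/ffunP => x; rewrite [LHS]ord1 [RHS]ord1. Qed.

(** The subset [{0}] of [int], with unit 0, is transported to ['I_1]. *)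
Lemma ring_str1_exists : exists s : ring_str 1, True.
Proof.
pose g (i : 'I_1) : int := 0.
have g_inj : injective g by move=> i j _; rewrite [i]ord1 [j]ord1.
have im x : (exists i, g i = x) <-> x = 0.
  by split=> [[i <-]|->] //; exists ord0.
have [||||||s _ _] := @ring_str_transport _ _ g 0 g_inj; last by exists s.
- by move=> x y; rewrite !im => -> ->.
- by move=> x y; rewrite !im => -> ->.
- by move=> x; rewrite !im => ->.
- by rewrite im.
- by rewrite im.
- by move=> x /im ->.
Qed.

(** * Coefficients of the zeta series and the Euler product *)

Section Species.
Variable X : functor.
Hypotheses (X_tame : tame X) (X_mult : Defs.multiplicative X).

Lemma zeta_hatE N : zeta_hat X N = (\sum_(s : ring_str N) weight X s)%:R / (N`!)%:R.
Proof. by rewrite /zeta_hat (fcardE (has_card_zeta X_tame N)). Qed.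

(** The only structure is the zero ring, on which [X] has one point because it preserves the
    terminal object. *)
Lemma zeta_hat1 : zeta_hat X 1 = 1.
Proof.
rewrite zeta_hatE divr1; have [s _] := ring_str1_exists.
rewrite (bigD1 s) //= big1 => [|t]; last by rewrite (ring_str1_uniq t s) eqxx.
have s0 : (1 : ring_of s) = 0 by rewrite [LHS]ord1 [RHS]ord1.
rewrite addn0 /weight asboolT; last exact: decomposable0.
have [x xP] := X_mult.1 _ s0.
rewrite (@fcardE _ 1) //; exists (fun=> ord0); exists (fun=> x) => [y|i].
  exact: esym (xP y).
exact: esym (ord1 i).
Qed.

Lemma log_factor_ppow p k q : prime p -> (0 < k)%N -> prime q -> q != p ->
  log_factor X q (p ^ k)%N = 0.
Proof.
move=> p_pr k0 q_pr qp; rewrite /log_factor lognX logn_prime //.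
rewrite (negbTE qp) muln0 expn0; case: ifP => // /andP[lt1 /eqP e1].
by rewrite e1 in lt1.
Qed.

Lemma sum_log_factor K p k : prime p -> (0 < k)%N -> (p ^ k <= K)%N ->
  \sum_(0 <= q < K.+1 | prime q) log_factor X q (p ^ k)%N =
  (Defs.fcard (X (Fpn p k)))%:R / k%:R.
Proof.
move=> p_pr k0 pkK.
have pK : (p < K.+1)%N by rewrite ltnS (leq_trans _ pkK) // -{1}(expn1 p) leq_exp2l ?prime_gt1.
rewrite big_mkcond big_mkord (bigD1 (Ordinal pK)) //= p_pr big1 ?addr0.
  rewrite /log_factor pfactorK // eqxx andbT -{1}(expn0 p) ltn_exp2l ?prime_gt1 //.
  by rewrite k0.
move=> q; rewrite -val_eqE /= => qp; case: ifP => // q_pr.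
exact: log_factor_ppow.
Qed.

Lemma log_factor_npow K d : (forall p k, prime p -> (0 < k)%N -> d <> (p ^ k)%N) ->
  \sum_(0 <= q < K.+1 | prime q) log_factor X q d = 0.
Proof.
move=> dP; rewrite big1 // => q q_pr; rewrite /log_factor.
case: ifP => // /andP[d1 /eqP de].
have [k0|k0] := posnP (logn q d); first by rewrite de k0 in d1.
by case: (dP q _ q_pr k0).
Qed.

(** Blocks of semisimple rings are finite fields, so their sizes are prime powers. *)
Lemma block_count_npow n d : (forall p k, prime p -> (0 < k)%N -> d <> (p ^ k)%N) ->
  block_count X n d = 0%N.
Proof.
move=> dP; rewrite /block_count big1 // => s _; rewrite /weight.
case: asboolP => [[I [F [phi [e sP]]]]|_]; last by rewrite mul0n.
rewrite (_ : [set _ | _] = set0) ?cards0 ?muln0 //; apply/setP => f; rewrite !inE.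
apply/andP => -[/asboolP/(primitive_decomp sP)[i ->]].
rewrite (block_size_dual sP) => /eqP dE.
by have [p [k [p_pr k0 Fi]]] := card_field_ppow (F i); apply: (dP p k); rewrite // -dE.
Qed.

(** For [d = p ^ k] this is [block_countP] divided by the factorials and by [k], the denominator in
    [log_factor]. For other [d] both sides vanish. *)
Lemma block_count_zeta K n d : (0 < n <= K)%N -> (d %| n)%N ->
  (block_count X n d)%:R / (n`!)%:R =
  (\sum_(0 <= q < K.+1 | prime q) log_factor X q d) * zeta_hat X (n %/ d)%N.
Proof.
case/andP=> n0 nK dn.
have [[p [k [p_pr k0 dE]]]|ndE] :=
  pselect (exists p k, [/\ prime p, (0 < k)%N & d = (p ^ k)%N]); last first.
  have dP p k : prime p -> (0 < k)%N -> d <> (p ^ k)%N.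
    by move=> p_pr k0 dE; apply: ndE; exists p, k.
  by rewrite block_count_npow // log_factor_npow // !mul0r.
have dK : (d <= K)%N by apply: leq_trans nK; apply: dvdn_leq.
rewrite {2}dE sum_log_factor -?dE //.
have nE : n = (p ^ k * (n %/ d))%N by rewrite -dE mulnC divnK.
have := block_countP X_tame X_mult p_pr (card_Fpn p_pr k0) nE.
rewrite -dE zeta_hatE => /(congr1 (fun m => m%:R : rat)).
rewrite !natrM => bE.
have f0 m : (m`!)%:R != 0 :> rat by rewrite pnatr_eq0 -lt0n fact_gt0.
have k0' : k%:R != 0 :> rat by rewrite pnatr_eq0 -lt0n.
rewrite mulf_div; apply/eqP; rewrite eqr_div ?mulf_neq0 //.
by rewrite bE [X in _ == X]mulrC.
Qed.

(** [sum_block_size] distributes the weight of [n] over the primitive idempotents, which are then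
    sorted by block size, a divisor of [n]. *)
Lemma sum_block_weight K n : (0 < n <= K)%N ->
  (prime_weight K n)%:R * (\sum_(s : ring_str n) weight X s)%:R =
  \sum_(d <- divisors n) (prime_weight K d)%:R * (block_count X n d)%:R :> rat.
Proof.
case/andP=> n0 nK.
transitivity (\sum_(s : ring_str n) \sum_(f : 'I_n | `[< primitive_idem (f : ring_of s) >])
   (weight X s)%:R * (prime_weight K (block_size (f : ring_of s)))%:R : rat).
  rewrite [X in _ * X]natr_sum mulr_sumr; apply: eq_bigr => s _; rewrite -mulr_sumr mulrC.
  rewrite /weight; case: asboolP => [[I [F [phi [e sP]]]]|_]; last by rewrite !mul0r.
  congr (_ * _).
  rewrite (sum_block_size sP (w := fun m => (prime_weight K m)%:R)) // => a b a0 b0.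
  by rewrite prime_weightM // natrD.
under [RHS]eq_bigr => d _ do rewrite /block_count [X in _ * X]natr_sum mulr_sumr.
rewrite exchange_big; apply: eq_bigr => s _ /=.
rewrite /weight; case: asboolP => [[I [F [phi [e sP]]]]|_]; last first.
  rewrite !big1 // => [d _|f _]; first by rewrite mul0n mulr0.
  by rewrite mul0r.
set c := Defs.fcard _.
transitivity (\sum_(f : 'I_n | `[< primitive_idem (f : ring_of s) >])
  \sum_(d <- divisors n) if block_size (f : ring_of s) == d then
     c%:R * (prime_weight K d)%:R else 0 : rat).
  apply: eq_bigr => f /asboolP/(primitive_decomp sP)[i ->].
  have Fi : #|F i| \in divisors n.
    rewrite -dvdn_divisors // [n](card_decomp sP) (bigD1 i) //=.
    exact: dvdn_mulr.
  rewrite (block_size_dual sP) (bigD1_seq _ Fi) ?divisors_uniq //= eqxx.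
  by rewrite big1 ?addr0 // => d dF; rewrite eq_sym (negbTE dF).
rewrite exchange_big; apply: eq_bigr => d _ /=.
rewrite -big_mkcondr /= sumr_const -[LHS]mulr_natr natrM [RHS]mulrCA -mulrA.
congr (_ * (_ * _%:R)).
by apply: eq_card => f; rewrite !inE.
Qed.

Lemma zeta_hat_prod N : (0 < N)%N ->
  zeta_hat X N = dprod_primes (fun p => dexp (log_factor X p)) N.
Proof.
move=> N0; rewrite /dprod_primes big_dmul //.
(* One bound [N] truncates both the weight and the product: primes above [N] affect no coefficient
   up to [N], and [w n] is nonzero for [1 < n <= N]. *)
pose w n : rat := (prime_weight N n)%:R.
have wM a b : (0 < a)%N -> (0 < b)%N -> w (a * b)%N = w a + w b.
  by move=> a0 b0; rewrite /w prime_weightM // natrD.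
have L1 p : log_factor X p 1 = 0 by [].
pose L n := \sum_(0 <= p < N.+1 | prime p) log_factor X p n.
apply: (dder_unique (w := w) (K := N) (h := dder w L)); rewrite ?N0 ?leqnn //.
- by move=> n n1; rewrite pnatr_eq0 -lt0n prime_weight_gt0.
- by rewrite /dder /L big1 ?mulr0.
- by rewrite zeta_hat1 prod_exp_at1.
- move=> n nN; have n0 : (0 < n)%N by case/andP: nN.
  rewrite /dder zeta_hatE mulrA sum_block_weight // mulr_suml cmul_pos //.
  apply: eq_big_seq => d; rewrite -dvdn_divisors // => dn.
  by rewrite -!mulrA (block_count_zeta nN dn).
by move=> n _; rewrite (dder_prod_exp wM).
Qed.

End Species.

End EulerProduct.

Theorem theorem5p1 (X : functor) :
  tame X -> multiplicative X ->
  (forall N : nat, (0 < N)%N -> finite_type (zeta_species X N)) /\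
  (forall N : nat, (0 < N)%N ->
     zeta_hat X N = dprod_primes (fun p => dexp (log_factor X p)) N).
Proof.
move=> X_tame X_mult; split=> N N0; last exact: zeta_hat_prod.
by eexists; apply: has_card_zeta.
Qed.
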